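(* Let $B>0$, let $F$ be the CDF of a continuous random variable with values in $[0,B]$, let $p\in(0,1)$, and let $x_p>0$ be the $p$-quantile of $F$. Suppose that $F$ is light-tailed beyond $x_p$. Let $X_1,\dots,X_n$ be independent random variables with CDF $F$, let $\tau\ge x_p$ and $r\ge 1$ be real numbers, and let $E_i=X_i-\min\{X_i,r\tau\}$ for $i=1,\dots,n$ (the outlier error of the $i$th observation when truncating at $r\tau$). Then for every $\beta_{\mathrm{out}}\in(0,1)$, $$\Pr\left[\sum_{i=1}^{n}E_i\ \ge\ \frac{-x_p}{\ln p}\left(\sqrt{p^{r}n}+\sqrt{\ln\frac{1}{\beta_{\mathrm{out}}}}\right)^{2}\right]\le\beta_{\mathrm{out}}.$$
   Context: The $p$-quantile of a CDF $F$ is $x_p=\inf\{x\in\mathbb{R}:F(x)\ge 1-p\}$. The exponential distribution with parameter $\gamma>0$ has CDF $H(x;\gamma)=1-e^{-\gamma x}$ for $x\ge 0$ and $H(x;\gamma)=0$ for $x<0$. $F$ is light-tailed beyond $x_p$ if, with $\gamma=-\frac{\ln p}{x_p}$ (so that the $p$-quantile of $H(\cdot;\gamma)$ equals $x_p$), one has $F(x)\ge H(x;\gamma)$ for all $x\ge x_p$. *)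

(* Defs.v *)
From HB Require Import structures.
From mathcomp Require Import all_boot all_order all_algebra.
From mathcomp Require Import all_classical all_reals all_analysis.
Set Implicit Arguments.
Unset Strict Implicit.
Unset Printing Implicit Defensive.
Import Order.TTheory GRing.Theory Num.Theory.
Import numFieldNormedType.Exports.

Local Open Scope classical_set_scope.
Local Open Scope ring_scope.

(* [cdf] takes values in \bar R; the order and analysis below are done with a
   real-valued F. *)
Definition has_cdf d (T : measurableType d) (R : realType)
    (P : probability T R) (X : {RV P >-> R}) (F : R -> R) : Prop :=
  forall x : R, cdf X x = (F x)%:E.

(* The quantile is indexed by the upper-tail mass p: the level is 1 - p.
   For a CDF F and 0 < p < 1 the set is nonempty and bounded below, so that
   [inf] is the genuine infimum. *)
Definition quantile (R : realType) (F : R -> R) (p : R) : R :=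
  inf [set x | 1 - p <= F x].

Definition exponential_cdf (R : realType) (gamma x : R) : R :=
  if 0 <= x then 1 - expR (- gamma * x) else 0.

Definition light_tailed (R : realType) (F : R -> R) (p : R) : Prop :=
  let xp := quantile F p in
  let gamma := - (ln p / xp) in
  forall x : R, xp <= x -> exponential_cdf gamma x <= F x.

(* Mutual independence: the product rule for every finite subfamily J. *)
Definition independent_RVs d (T : measurableType d) (R : realType)
    (P : probability T R) (n : nat) (X : 'I_n -> {RV P >-> R}) : Prop :=
  forall (J : {set 'I_n}) (A : 'I_n -> set R),
    (forall i, measurable (A i)) ->
    P (\bigcap_(i in [set` J]) X i @^-1` A i)
      = (\prod_(i in J) P (X i @^-1` A i))%E.

Definition outlier_error (R : realType) (c x : R) : R := x - Num.min x c.

(* Main.v *)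
(** Write gamma = - ln p / x_p. Light-tailedness gives P(E_i > t) <= p^r exp(- gamma t)
    for t >= 0, hence E(exp(l E_i)) <= 1 + p^r l / (gamma - l) for 0 < l < gamma.
    Chernoff's bound on the sum, with a = p^r n, b = ln (1 / beta_out) and
    l = gamma sqrt b / (sqrt a + sqrt b), yields exactly exp(- b) = beta_out. *)
Require Import Defs.
From HB Require Import structures.
From mathcomp Require Import all_boot all_order all_algebra.
From mathcomp Require Import all_classical all_reals all_analysis.
From mathcomp Require Import measurable_realfun.
From mathcomp Require Import ring lra.
Set Implicit Arguments.
Unset Strict Implicit.
Unset Printing Implicit Defensive.
Import Order.TTheory GRing.Theory Num.Theory.
Import numFieldNormedType.Exports.

Local Open Scope classical_set_scope.
Local Open Scope ring_scope.

(** * Layer cake formula and expectations of independent products *)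

Lemma measurable_indic_itv0 d (T : measurableType d) (R : realType)
    (g : T -> R) : measurable_fun setT g ->
  measurable_fun setT
    (fun z : T * measurableTypeR R => \1_`[0, g z.1[ z.2 : R).
Proof.
move=> mg; apply: measurable_indic.
rewrite [X in measurable X](_ : _ =
    [set z : T * measurableTypeR R | 0 <= z.2] `&` [set z | z.2 < g z.1]).
  apply: measurableI.
    have : measurable_fun setT (fun z : T * measurableTypeR R => 0 <= z.2).
      exact: measurable_fun_ler.
    by move=> /(_ measurableT [set true]); rewrite setTI; exact.
  have : measurable_fun setT (fun z : T * measurableTypeR R => z.2 < g z.1).
    by apply: measurable_fun_ltr => //; exact: measurableT_comp.
  by move=> /(_ measurableT [set true]); rewrite setTI; exact.
by apply/seteqP; split => z /=; rewrite in_itv/= => /andP.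
Qed.

(** The value [g w] is the Lebesgue measure of [[0, g w[], and Tonelli's theorem swaps the two
    integrals. The weight [W] will carry the remaining factors of a product. *)
Lemma weighted_layer_cake d (T : measurableType d) (R : realType)
    (P : probability T R) (W g : T -> R) :
  measurable_fun setT W -> measurable_fun setT g ->
  (forall w, 0 <= W w) -> (forall w, 0 <= g w) ->
  (\int[P]_w (W w * g w)%:E =
   \int[lebesgue_measure]_t \int[P]_w (W w * \1_`[0, g w[ t)%:E)%E.
Proof.
move=> mW mg W0 g0.
rewrite -(fubini_tonelli
  (fun z : T * measurableTypeR R =>
    (W z.1 * \1_`[0, g z.1[ z.2)%:E))/=; first last.
- by move=> z; rewrite lee_fin mulr_ge0.
- apply/measurable_EFinP; apply: measurable_funM; first exact: measurableT_comp.
  exact: measurable_indic_itv0.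
apply: eq_integral => w _.
under eq_integral do rewrite EFinM.
rewrite ge0_integralZl//; last 2 first.
- by apply/measurable_EFinP; exact: measurable_indic.
- by rewrite lee_fin.
rewrite integral_indic//= setIT lebesgue_measure_itv/= lte_fin EFinM.
by case: ltgtP (g0 w) => //= [g_gt0 _|<- _]; rewrite ?sube0.
Qed.

Lemma independent_integral_prod d (T : measurableType d) (R : realType)
    (P : probability T R) (n : nat) (X : 'I_n -> {RV P >-> R})
    (h : 'I_n -> R -> R) :
  independent_RVs X ->
  (forall i, measurable_fun setT (h i)) -> (forall i x, 0 <= h i x) ->
  (\int[P]_w (\prod_i h i (X i w))%:E = \prod_i \int[P]_w (h i (X i w))%:E)%E.
Proof.
move=> indX.
(* Induction on k, the factors of index at least k being indicators: by the layer
   cake formula, the k-th factor is a mixture of indicators of its superlevel sets. *)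
suff main (k : nat) (f : 'I_n -> R -> R) :
    (forall i, measurable_fun setT (f i)) -> (forall i x, 0 <= f i x) ->
    (forall i : 'I_n, (k <= i)%N ->
      exists2 A : set R, measurable A & f i = \1_A) ->
    (\int[P]_w (\prod_i f i (X i w))%:E =
     \prod_i \int[P]_w (f i (X i w))%:E)%E.
  by move=> mh h0; apply: (main n) => // i; rewrite leqNgt ltn_ord.
elim: k f => [|k IH] f mf f0 f_indic.
  (* All factors are indicators here, so their product is the indicator of an intersection of
     preimages, and independence applies with the full index set. *)
  have /choice[A AP] : forall i, exists A : set R, measurable A /\ f i = \1_A.
    by move=> i; have [A mA fA] := f_indic i isT; exists A.
  have mXA i : measurable (X i @^-1` A i).
    by apply: measurable_funPTI; exact: (AP i).1.
  have intA i : (\int[P]_w (f i (X i w))%:E = P (X i @^-1` A i))%E.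
    transitivity (\int[P]_w (\1_(X i @^-1` A i) w)%:E)%E.
      by apply: eq_integral => w _; rewrite (AP i).2.
    by rewrite integral_indic// setIT.
  under [RHS]eq_bigr do rewrite intA.
  have := indX [set: 'I_n]%SET A (fun i => (AP i).1).
  under [in X in _ = X -> _]eq_bigl do rewrite inE.
  move=> <-.
  set C := \bigcap_(i in _) _.
  have mC : measurable C by apply: fin_bigcap_measurable.
  rewrite -[C]setIT -integral_indic//; apply: eq_integral => w _; congr EFin.
  have [Cw|nCw] := pselect (C w).
    rewrite indicE mem_set// big1// => i _.
    by rewrite (AP i).2 indicE mem_set//; apply: Cw; rewrite /= inE.
  rewrite indicE memNset//; apply/eqP; rewrite prodf_seq_eq0.
  have [i /= nAi] : exists i, ~ A i (X i w).
    by apply: contra_notP nCw => /forallNP nA i _; exact: contrapT (nA i).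
  apply/hasP; exists i; first by rewrite mem_index_enum.
  by rewrite /= (AP i).2 indicE memNset.
(* For [n <= k] there is no [k]-th factor and the condition on indicators is vacuous. *)
have [nk|kn] := leqP n k.
  by apply: IH => // i /(leq_trans nk); rewrite leqNgt ltn_ord.
pose j := Ordinal kn.
(* The superlevel set of [f j] at height [t], empty for negative [t] because the layers start at
   0. *)
pose A t : set R := [set y | `[0, f j y[%classic t].
have mA t : measurable (A t).
  rewrite (_ : A t = f j @^-1` (if 0 <= t then `]t, +oo[%classic else set0)).
    by rewrite -[X in measurable X]setTI; apply: mf => //; case: ifP.
  apply/seteqP; split => y; rewrite /A/= in_itv/=; case: ifP => //=;
    by rewrite in_itv/= andbT.
(* With its [j]-th factor replaced by an indicator, the family satisfies the induction hypothesis
   for each fixed [t]. *)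
pose f' t (i : 'I_n) := if i == j then \1_(A t) else f i.
have f'j t w : f' t j (X j w) = \1_`[0, f j (X j w)[ t.
  by rewrite /f' eqxx !indicE.
have f'Nj t i : i != j -> f' t i = f i by rewrite /f' => /negbTE ->.
have IHt t : (\int[P]_w (\prod_i f' t i (X i w))%:E =
     \prod_i \int[P]_w (f' t i (X i w))%:E)%E.
  apply: IH => [i|i x|i].
  - by rewrite /f'; case: eqP => // _; exact: measurable_indic.
  - by rewrite /f'; case: eqP.
  - rewrite leq_eqVlt => /predU1P[kj|ki].
      by exists (A t) => //; rewrite /f' (_ : i = j) ?eqxx//; exact/val_inj.
    have [B mB fB] := f_indic i ki; exists B => //.
    by rewrite f'Nj// -val_eqE/= gtn_eqF.
pose W w := \prod_(i | i != j) f i (X i w).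
have mfX i : measurable_fun setT (fun w => f i (X i w)).
  exact: measurableT_comp.
have mW : measurable_fun setT W.
  rewrite /W; under eq_fun do rewrite -big_filter.
  exact: measurable_prod.
have W0 w : 0 <= W w by apply: prodr_ge0.
under eq_integral do rewrite (bigD1 j)//= mulrC.
rewrite (weighted_layer_cake P mW)//.
rewrite (bigD1 j)//=; set C := (\prod_(i | _) _)%E.
have C0 : (0 <= C)%E.
  by apply: prode_ge0 => i _; apply: integral_ge0 => w _; rewrite lee_fin.
(* The factor 1 is a trivial weight: once the constant [C] is pulled out, the layer cake formula is
   read backwards with it to restore the integral of [f j]. *)
transitivity (\int[lebesgue_measure]_t
    (C * \int[P]_w (1 * \1_`[0%R, f j (X j w)[ t)%:E))%E.
  apply: eq_integral => t _.
  transitivity (\int[P]_w (\prod_i f' t i (X i w))%:E)%E.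
    apply: eq_integral => w _; rewrite (bigD1 j)//= f'j mulrC; congr (_ * _)%:E.
    by apply: eq_bigr => i ij; rewrite f'Nj.
  rewrite IHt (bigD1 j)//= muleC; congr (_ * _)%E.
    by apply: eq_bigr => i ij; rewrite f'Nj.
  by apply: eq_integral => w _; rewrite f'j mul1r.
rewrite ge0_integralZl//; last 2 first.
- apply: (measurable_fun_fubini_tonelli_G
    (fun z : T * measurableTypeR R => (1 * \1_`[0, f j (X j z.1)[ z.2)%:E)).
    apply/measurable_EFinP; under eq_fun do rewrite mul1r.
    exact: measurable_indic_itv0 (mfX j).
  by move=> z; rewrite mul1r lee_fin.
- by move=> t _; apply: integral_ge0 => w _; rewrite mul1r lee_fin.
rewrite -weighted_layer_cake// muleC.
by under eq_integral do rewrite mul1r.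
Qed.

(** * Exponential moments from an exponential tail *)

Lemma cvg_ln_pinfty (R : realType) : ln (x : R) @[x --> +oo] --> +oo.
Proof.
apply/cvgryPge => A; near=> x.
have xA : expR A <= x by near: x; exact: nbhs_pinfty_ge.
by rewrite -[A]expRK ler_ln ?posrE ?expR_gt0// (lt_le_trans _ xA)// expR_gt0.
Unshelve. all: by end_near. Qed.

(* For a random variable Z with P(Z > t) <= q exp(- gamma t), this is the integral
   bounding E(expR (l Z) - 1), with k + 1 = gamma / l. *)
Lemma integral_pareto (R : realType) (q k : R) : 0 <= q -> 0 < k ->
  (\int[lebesgue_measure]_(t in `[0%R, +oo[)
     (q * expR (- (k + 1) * ln (1 + t)))%:E = (q / k)%:E)%E.
Proof.
move=> q0 k0.
(* The antiderivative [- (q / k) (1 + t)^(- k)], the power being written through [expR] and [ln]. It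
   equals [- (q / k)] at 0 and tends to 0 at infinity. *)
pose F (t : R) := - (q / k) * expR (- k * ln (1 + t)).
have dln (t : R) : 0 <= t -> is_derive t 1 (fun t => ln (1 + t)) (1 + t)^-1.
  move=> t0; have t1 : 0 < 1 + t by lra.
  have d1 : is_derive t 1 (fun t : R => 1 + t) 1.
    by apply: is_derive_eq; rewrite add0r mulr1.
  have dln := is_derive1_ln t1.
  by have := is_derive1_comp dln d1; rewrite mulr1.
have dexp (c t : R) : 0 <= t ->
    is_derive t 1 (fun t => expR (c * ln (1 + t)))
      (c * expR ((c - 1) * ln (1 + t))).
  move=> t0; have t1 : 0 < 1 + t by lra.
  have dc : is_derive t 1 (fun t : R => c * ln (1 + t)) (c * (1 + t)^-1).
    by have dln' := dln t t0; apply: is_derive_eq.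

  have := is_derive1_comp (is_derive_expR _) dc.
  congr (is_derive _ _ _ _).
  by rewrite mulrBl mul1r expRD expRN lnK ?posrE//; ring.
have dF (t : R) : 0 <= t ->
    is_derive t 1 F (q * expR (- (k + 1) * ln (1 + t))).
  move=> t0; have := dexp (- k) t t0; rewrite -opprD => de.
  rewrite /F; apply: is_derive_eq.
  rewrite /GRing.scale/=; field; lra.
have cF (f df : R -> R) : (forall t : R, 0 <= t -> is_derive t 1 f (df t)) ->
    {within `[0, +oo[, continuous f}.
  move=> dF'; apply: derivable_within_continuous => t.
  by rewrite in_itv/= andbT => /dF'[].
rewrite (ge0_continuous_FTC2y (F := F) (l := 0)).
- rewrite /F addr0 ln1 mulr0 expR0 mulr1 -EFinB sub0r opprK//.
- by move=> t _; rewrite mulr_ge0// expR_ge0.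
- pose df t := q * (- (k + 1) * expR ((- (k + 1) - 1) * ln (1 + t))).
  pose f t := q * expR (- (k + 1) * ln (1 + t)).
  have dfE (t : R) : 0 <= t -> is_derive t 1 f (df t).
    by move=> t0; have de := dexp (- (k + 1)) t t0; exact: is_derive_eq.
  exact: (cF f df).
- rewrite /F -(mulr0 (- (q / k))); apply: cvgMl_tmp.
  have cvg_exponent : k * ln (1 + t) @[t --> +oo] --> +oo.
    apply: gt0_cvgMry => //.
    exact: (cvg_comp (fun t : R => 1 + t) _ (cvg_addrl 1) (@cvg_ln_pinfty R)).
  have := cvg_comp _ _ cvg_exponent (@cvgr_expR R).
  by apply: cvg_trans; apply: near_eq_cvg; near=> t; rewrite /= mulNr.
- by move=> t /ltW/dF[].
- by have /continuous_within_itvcyP[] := cF F _ dF.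
- by move=> t; rewrite in_itv/= andbT => /ltW/dF; rewrite derive1E => -[].
Unshelve. all: by end_near. Qed.

(** The variable [G = expR (l * Z) - 1] is nonnegative, so its mean is the integral of P(G > t) over
    [t >= 0]. Since G > t means Z > ln (1 + t) / l, the tail bound turns into
    [q (1 + t)^(- gamma / l)], whose integral is the Pareto one with [k = gamma / l - 1]; it is
    finite because [l < gamma]. *)
Lemma mmt_gen_le_exponential_tail d (T : measurableType d) (R : realType)
    (P : probability T R) (Z : T -> R) (q gamma l : R) :
  measurable_fun setT Z -> (forall w, 0 <= Z w) ->
  0 <= q -> 0 < l < gamma ->
  (forall t, 0 <= t ->
    (P [set w | (t < Z w)%R] <= (q * expR (- gamma * t))%:E)%E) ->
  (\int[P]_w (expR (l * Z w))%:E <= (1 + q * (l / (gamma - l)))%:E)%E.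
Proof.
move=> mZ Z0 q0 /andP[l0 lg] tailZ.
pose G w := expR (l * Z w) - 1.
have mG : measurable_fun setT G.
  apply: measurable_funB => //; apply: measurableT_comp => //.
  exact: measurable_funM.
have G0 w : 0 <= G w by rewrite subr_ge0 -expR0 ler_expR mulr_ge0// ltW.
pose GX : {RV P >-> R} := HB.pack G (isMeasurableFun.Build _ _ _ _ G mG).
have -> : (\int[P]_w (expR (l * Z w))%:E = 1 + 'E_P[GX])%E.
  rewrite expectation_def.
  transitivity (\int[P]_w (1 + (G w)%:E))%E.
    by apply: eq_integral => w _; rewrite -EFinD /G addrC subrK.
  rewrite ge0_integralD//.
  - by rewrite (integral_cst P measurableT 1%E) /= probability_setT mul1e.
  - by move=> w _; rewrite lee_fin.
  - exact/measurable_EFinP.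
rewrite EFinD leeD2l// ge0_expectation_ccdf//.
have -> : q * (l / (gamma - l)) = q / (gamma / l - 1) by field; lra.
rewrite -integral_pareto ?subr_gt0 ?ltr_pdivlMr ?mul1r//.
apply: ge0_le_integral => //.
- by apply: measurable_funTS; exact: ccdf_measurable.
- apply/measurable_EFinP; apply: measurable_funTS.
  apply: measurable_funM => //; apply: measurableT_comp => //.
  apply: measurable_funM => //; apply: measurableT_comp => //.
  exact: measurable_funD.
move=> t /=; rewrite in_itv/= andbT => t0.
have GE w : (t < G w) = (ln (1 + t) / l < Z w).
  rewrite /G ltrBrDl ltr_pdivrMr// (mulrC (Z w)) -[RHS]ltr_expR lnK// posrE.
  by rewrite (lt_le_trans ltr01)// lerDl.
have -> : ccdf GX t = P [set w | ln (1 + t) / l < Z w].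
  by congr (P _); apply/seteqP; split => w /=; rewrite in_itv/= andbT GE.
have t1 : 0 <= ln (1 + t) by rewrite ln_ge0// lerDl.
apply: le_trans (tailZ _ _) _; first by rewrite divr_ge0// ltW.
rewrite lee_fin subrK le_eqVlt; apply/orP; left; apply/eqP.
by congr (q * expR _); field; lra.
Qed.

(** * Chernoff's bound and the choice of its parameter *)

(** This [l] minimises the exponent over []0, g[]. With [u], [v] the roots of [a], [b], one gets
    [l / (g - l) = v / u], so the two terms are [u v] and [v (u + v)], and their difference is
    [- v ^+ 2]. *)
Lemma chernoff_exponent (R : rcfType) (g a b : R) : 0 < g -> 0 < a -> 0 < b ->
  let l := g * Num.sqrt b / (Num.sqrt a + Num.sqrt b) in
  0 < l < g /\
  a * (l / (g - l)) - l * (g^-1 * (Num.sqrt a + Num.sqrt b) ^+ 2) = - b.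
Proof.
move=> g0 a0 b0; set u := Num.sqrt a; set v := Num.sqrt b => /=.
have u0 : 0 < u by rewrite sqrtr_gt0.
have v0 : 0 < v by rewrite sqrtr_gt0.
have uv : 0 < u + v by lra.
split; first by rewrite divr_gt0 ?mulr_gt0//= ltr_pdivrMr// ltr_pM2l//; lra.
rewrite -(sqr_sqrtr (ltW a0)) -(sqr_sqrtr (ltW b0)) -/u -/v.
have -> : g - g * v / (u + v) = g * u / (u + v) by field; lra.
by field; rewrite ?mulf_neq0//; lra.
Qed.

Lemma chernoff_independent_sum d (T : measurableType d) (R : realType)
    (P : probability T R) (n : nat) (X : 'I_n -> {RV P >-> R}) (g : R -> R)
    (l s m : R) :
  independent_RVs X -> measurable_fun setT g -> 0 < l ->
  (forall i, (\int[P]_w (expR (l * g (X i w)))%:E <= (expR m)%:E)%E) ->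
  (P [set w | (s <= \sum_i g (X i w))%R]
   <= (expR (n%:R * m - l * s))%:E)%E.
Proof.
move=> indX mg l0 mgf.
have mS : measurable_fun setT (fun w => \sum_i g (X i w)).
  by apply: measurable_sum => i; exact: measurableT_comp.
pose S : {RV P >-> R} := HB.pack (fun w => \sum_i g (X i w))
  (isMeasurableFun.Build _ _ _ _ _ mS).
apply: le_trans (chernoff S s l0) _.
rewrite expRD EFinM lee_wpmul2r ?lee_fin ?expR_ge0// /mmt_gen_fun unlock/=.
have -> : (\int[P]_w (expR ((\sum_i g (X i w)) * l))%:E =
    \prod_i \int[P]_w (expR (l * g (X i w)))%:E)%E.
  rewrite -(independent_integral_prod (h := fun _ x => expR (l * g x)))//.
  - by apply: eq_integral => w _; rewrite mulrC mulr_sumr expR_sum.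
  - by move=> i; apply: measurableT_comp => //; exact: measurable_funM.
have -> : expR (n%:R * m) = \prod_(i < n) expR m.
  by rewrite prodr_const card_ord expRM_natl.
(* Products in [\bar R] are monotone only for nonnegative factors, so nonnegativity is carried along
   with the inequality. *)
rewrite -prodEFin; pose ge0_le (x y : \bar R) := (0 <= x /\ x <= y)%E.
suff [] : ge0_le (\prod_i \int[P]_w (expR (l * g (X i w)))%:E)%E
  (\prod_(i < n) (expR m)%:E)%E by [].
apply: (big_ind2 ge0_le) => [|x1 x2 y1 y2 [x0 x12] [y0 y12]|i _].
- by split; rewrite ?lee01.
- by split; [exact: mule_ge0|exact: lee_pmul].
- by split=> //; apply: integral_ge0 => w _; rewrite lee_fin expR_ge0.
Qed.

Lemma outlier_error_ge0 (R : realType) (c x : R) : 0 <= outlier_error c x.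
Proof. by rewrite subr_ge0 ge_min lexx. Qed.

(** For [x <= c] the error is 0 and both sides are false, thanks to [0 <= t]. *)
Lemma lt_outlier_error (R : realType) (c t x : R) : 0 <= t ->
  (t < outlier_error c x) = (c + t < x).
Proof.
move=> t0; rewrite /outlier_error ltrBrDr.
have [xc|cx] := leP x c; last by rewrite addrC.
by apply/idP/idP; lra.
Qed.

Lemma measurable_outlier_error (R : realType) (c : R) :
  measurable_fun setT (outlier_error c).
Proof. by apply: measurable_funB => //; exact: measurable_minr. Qed.

Theorem mainTheorem3 (R : realType) (B : R) (hB : 0 < B)
    (dY : measure_display) (TY : measurableType dY) (PY : probability TY R)
    (Y : {RV PY >-> R}) (hY : forall w : TY, 0 <= Y w <= B)
    (F : R -> R) (hYF : has_cdf Y F) (hFc : continuous F)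
    (p : R) (hp : 0 < p < 1)
    (xp : R) (hxp : xp = quantile F p) (hxp0 : 0 < xp)
    (hlight : light_tailed F p)
    (d : measure_display) (T : measurableType d) (P : probability T R)
    (n : nat) (X : 'I_n -> {RV P >-> R})
    (hXF : forall i : 'I_n, has_cdf (X i) F)
    (hindep : independent_RVs X)
    (tau : R) (htau : xp <= tau) (r : R) (hr : 1 <= r)
    (beta_out : R) (hbeta : 0 < beta_out < 1) :
  (P [set w : T | ((- xp / ln p)
                   * (Num.sqrt (p `^ r * n%:R)
                      + Num.sqrt (ln (1 / beta_out))) ^+ 2
                   <= \sum_(i < n) outlier_error (r * tau) (X i w))%R]
   <= beta_out%:E)%E.
Proof.
have [p0 p1] := andP hp; have [b0 b1] := andP hbeta.
have lnp : ln p < 0 by rewrite ln_lt0// hp.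
pose gamma := - (ln p / xp).
have g0 : 0 < gamma by rewrite oppr_gt0 pmulr_llt0 ?invr_gt0.
have -> : - xp / ln p = gamma^-1 by rewrite /gamma; field; lra.
have lnb : 0 < ln (1 / beta_out) by rewrite ln_gt0// ltr_pdivlMr// mul1r.
(* For [n = 0] the parameter [a = p^r n] vanishes and [chernoff_exponent] does not apply; but then
   the empty sum stays below the positive threshold and the event is empty. *)
case: n X hXF hindep => [|n'] X' hX' indX'.
  rewrite (_ : [set _ | _] = set0) ?measure0 ?lee_fin ?(ltW b0)//.
  apply/seteqP; split => w //=; rewrite big_ord0 leNgt => /negP; apply.
  by rewrite mulr_gt0 ?invr_gt0// exprn_gt0// ltr_wpDl ?sqrtr_ge0 ?sqrtr_gt0.
set q := p `^ r; have q0 : 0 < q by rewrite powR_gt0.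
have a0 : 0 < q * n'.+1%:R by rewrite mulr_gt0.
have := chernoff_exponent g0 a0 lnb.
set l := (gamma * _ / _) => /= -[lg exponent].
have [l0 lltg] := andP lg.
have rtau : r * xp <= r * tau by rewrite ler_wpM2l//; lra.
(* Since [r >= 1], the truncation point lies in the range where light-tailedness applies. *)
have xp_rtau : xp <= r * tau by apply: le_trans rtau; rewrite ler_peMl// ltW.
have tail i t : 0 <= t ->
    (P [set w | (t < outlier_error (r * tau) (X' i w))%R]
     <= (q * expR (- gamma * t))%:E)%E.
  move=> t0.
  have -> : [set w | t < outlier_error (r * tau) (X' i w)] =
      X' i @^-1` `]r * tau + t, +oo[.
    by apply/seteqP; split => w /=; rewrite lt_outlier_error// in_itv/= andbT.
  rewrite -[X in (X <= _)%E]/(ccdf (X' i) (r * tau + t)) ccdf_1_cdf hX'.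
  have xpt : xp <= r * tau + t by rewrite (le_trans xp_rtau)// lerDl.
  move: (hlight (r * tau + t)); rewrite -hxp -/gamma => /(_ xpt).
  rewrite /exponential_cdf (le_trans (ltW hxp0) xpt) -EFinB lee_fin.
  rewrite lerBlDl -lerBlDr => hF.
  apply: le_trans hF _.
  (* By the choice of [gamma], [p^r = expR (- gamma * (r * xp))], so the factor [p^r] comes from
     [r * xp <= r * tau]. *)
  rewrite /q /powR gt_eqF// -expRD ler_expR.
  have -> : r * ln p = - gamma * (r * xp) by rewrite /gamma; field; lra.
  by rewrite mulrDr lerD2r ler_nM2l ?oppr_lt0.
(* The moment bound [1 + m] is relaxed to [expR m], so that the product over the sample becomes
   [expR (n m)]. *)
pose m := q * (l / (gamma - l)).
apply: le_trans (chernoff_independent_sum _ (m := m) indX'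
  (@measurable_outlier_error R (r * tau)) l0 _) _ => [i|].
  apply: le_trans (mmt_gen_le_exponential_tail _ _ (ltW q0) lg (tail i)) _.
  - by apply: measurableT_comp => //; exact: measurable_outlier_error.
  - by move=> w; exact: outlier_error_ge0.
  - by rewrite lee_fin expR_ge1Dx.
rewrite lee_fin /m mulrA (mulrC _ q) exponent.
by rewrite div1r lnV ?posrE// opprK lnK.
Qed.
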